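(* Let $X$ be a semi-transitive biquandle, let $R$ be a commutative ring with unity, and let $(A,B)$ be an $X$-bracket with values in $R$. Then $A$ is a biquandle $2$-cocycle up to a constant multiple.
   Context: A biquandle is a set $X$ with two binary operations $\underline{\triangleright},\overline{\triangleright}$ such that for all $x,y,z\in X$: (i) $x\,\underline{\triangleright}\,x = x\,\overline{\triangleright}\,x$; (ii) the maps $\alpha_y:X\to X$, $\alpha_y(x)=x\,\overline{\triangleright}\,y$, $\beta_y:X\to X$, $\beta_y(x)=x\,\underline{\triangleright}\,y$, and $S:X\times X\to X\times X$, $S(x,y)=(y\,\overline{\triangleright}\,x,\ x\,\underline{\triangleright}\,y)$, are invertible; (iii) the exchange laws hold: $(x\,\underline{\triangleright}\,y)\,\underline{\triangleright}\,(z\,\underline{\triangleright}\,y)=(x\,\underline{\triangleright}\,z)\,\underline{\triangleright}\,(y\,\overline{\triangleright}\,z)$, $(x\,\underline{\triangleright}\,y)\,\overline{\triangleright}\,(z\,\underline{\triangleright}\,y)=(x\,\overline{\triangleright}\,z)\,\underline{\triangleright}\,(y\,\overline{\triangleright}\,z)$, $(x\,\overline{\triangleright}\,y)\,\overline{\triangleright}\,(z\,\overline{\triangleright}\,y)=(x\,\overline{\triangleright}\,z)\,\overline{\triangleright}\,(y\,\underline{\triangleright}\,z)$. A biquandle $X$ is semi-transitive if there exists $x\in X$ such that $\{x\,\underline{\triangleright}\,y : y\in X\}\cup\{x\,\overline{\triangleright}\,y : y\in X\}=X$. Let $R$ be a commutative ring with unity, with unit group $R^\times$. A biquandle bracket on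 $X$ with values in $R$, also called an $X$-bracket, is a pair of maps $A,B:X\times X\to R^\times$ (written $A_{x,y}$, $B_{x,y}$) together with elements $\delta\in R$ and $w\in R^\times$ such that: (i) for all $x\in X$, $\delta A_{x,x}+B_{x,x}=w$ and $\delta A_{x,x}^{-1}+B_{x,x}^{-1}=w^{-1}$; (ii) for all $x,y\in X$, $\delta=-A_{x,y}B_{x,y}^{-1}-A_{x,y}^{-1}B_{x,y}$; (iii) for all $x,y,z\in X$: $A_{x,y}A_{y,z}A_{x\underline{\triangleright}y,\,z\overline{\triangleright}y}=A_{x,z}A_{y\overline{\triangleright}x,\,z\overline{\triangleright}x}A_{x\underline{\triangleright}z,\,y\underline{\triangleright}z}$, $A_{x,y}B_{y,z}B_{x\underline{\triangleright}y,\,z\overline{\triangleright}y}=B_{x,z}B_{y\overline{\triangleright}x,\,z\overline{\triangleright}x}A_{x\underline{\triangleright}z,\,y\underline{\triangleright}z}$, $B_{x,y}A_{y,z}B_{x\underline{\triangleright}y,\,z\overline{\triangleright}y}=B_{x,z}A_{y\overline{\triangleright}x,\,z\overline{\triangleright}x}B_{x\underline{\triangleright}z,\,y\underline{\triangleright}z}$, $A_{x,y}A_{y,z}B_{x\underline{\triangleright}y,\,z\overline{\triangleright}y}=A_{x,z}B_{y\overline{\triangleright}x,\,z\overline{\triangleright}x}A_{x\underline{\triangleright}z,\,y\underline{\triangleright}z}+A_{x,z}A_{y\overline{\triangleright}x,\,z\overline{\triangleright}x}B_{x\underline{\triangleright}z,\,y\underline{\triangleright}z}+\delta A_{x,z}B_{y\overline{\triangleright}x,\,z\overline{\triangleright}x}B_{x\underline{\triangleright}z,\,y\underline{\triangleright}z}+B_{x,z}B_{y\overline{\triangleright}x,\,z\overline{\triangleright}x}B_{x\underline{\triangleright}z,\,y\underline{\triangleright}z}$,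 $B_{x,z}A_{y\overline{\triangleright}x,\,z\overline{\triangleright}x}A_{x\underline{\triangleright}z,\,y\underline{\triangleright}z}=B_{x,y}A_{y,z}A_{x\underline{\triangleright}y,\,z\overline{\triangleright}y}+A_{x,y}B_{y,z}A_{x\underline{\triangleright}y,\,z\overline{\triangleright}y}+\delta B_{x,y}B_{y,z}A_{x\underline{\triangleright}y,\,z\overline{\triangleright}y}+B_{x,y}B_{y,z}B_{x\underline{\triangleright}y,\,z\overline{\triangleright}y}$. Since $\delta$ and $w$ are determined by $A$ and $B$, the bracket is denoted simply $(A,B)$; a pair $(A,B)$ is called an $X$-bracket if there exist such $\delta,w$. For an abelian group $G$ written multiplicatively, a biquandle $2$-cocycle is a function $\phi:X\times X\to G$ such that for all $x,y,z\in X$: $\phi(x,x)=1$ and $\phi(x,y)\,\phi(y,z)\,\phi(x\,\underline{\triangleright}\,y,\ z\,\overline{\triangleright}\,y)=\phi(x,z)\,\phi(y\,\overline{\triangleright}\,x,\ z\,\overline{\triangleright}\,x)\,\phi(x\,\underline{\triangleright}\,z,\ y\,\underline{\triangleright}\,z)$. Here $G=R^\times$. A function $\phi:X\times X\to R^\times$ is a biquandle $2$-cocycle up to a constant multiple if $\phi=c\cdot\psi$ for some $c\in R^\times$ and some biquandle $2$-cocycle $\psi:X\times X\to R^\times$. *)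

(* Defs.v *)
From HB Require Import structures.
From mathcomp Require Import all_boot all_algebra.

Set Implicit Arguments.
Unset Strict Implicit.
Unset Printing Implicit Defensive.

Import GRing.Theory.

Record biquandle := Biquandle {
  biq_sort :> Type;
  biq_under : biq_sort -> biq_sort -> biq_sort;
  biq_over : biq_sort -> biq_sort -> biq_sort;
  biq_diag : forall x, biq_under x x = biq_over x x;
  biq_over_bij : forall y, bijective (fun x => biq_over x y);
  biq_under_bij : forall y, bijective (fun x => biq_under x y);
  biq_switch_bij :
    bijective (fun p : biq_sort * biq_sort =>
                 (biq_over p.2 p.1, biq_under p.1 p.2));
  biq_exchange_uu : forall x y z,
    biq_under (biq_under x y) (biq_under z y)
    = biq_under (biq_under x z) (biq_over y z);
  biq_exchange_uo : forall x y z,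
    biq_over (biq_under x y) (biq_under z y)
    = biq_under (biq_over x z) (biq_over y z);
  biq_exchange_oo : forall x y z,
    biq_over (biq_over x y) (biq_over z y)
    = biq_over (biq_over x z) (biq_under y z)
}.

Notation "x '\under' y" := (biq_under x y) (at level 40, left associativity).
Notation "x '\over' y" := (biq_over x y) (at level 40, left associativity).

Definition semi_transitive (X : biquandle) : Prop :=
  exists x : X, forall z : X,
    (exists y : X, z = x \under y) \/ (exists y : X, z = x \over y).

(* The unit group of an arbitrary commutative ring, the zero ring included.
   A unit is stored together with its inverse, so that no decision procedure
   for invertibility is required of R; since the inverse is unique, units are
   determined by their value (lemma uval_inj). *)
Section Units.
Local Open Scope ring_scope.
Variable R : comPzRingType.

Record units := Units {
  unit_pair : R * R;
  unit_pairP : unit_pair.1 * unit_pair.2 == 1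
}.

HB.instance Definition _ := [isSub for unit_pair].
HB.instance Definition _ := [Choice of units by <:].

Definition uval (u : units) : R := (unit_pair u).1.

Lemma uval_inj : injective uval.
Proof.
move=> [[a b] Hab] [[c d] Hcd]; rewrite /uval /= => ac.
apply: val_inj => /=; have /eqP ab := Hab; have /eqP /= := Hcd.
rewrite -ac => ad; congr pair; rewrite /= in ab.
by rewrite -[b]mulr1 -ad mulrA [b * a]mulrC ab mul1r.
Qed.

Fact units_mul_subproof (u v : units) :
  (unit_pair u).1 * (unit_pair v).1 * ((unit_pair u).2 * (unit_pair v).2) == 1.
Proof. by rewrite mulrACA (eqP (unit_pairP u)) (eqP (unit_pairP v)) mul1r. Qed.

Fact units_one_subproof : (1 : R) * 1 == 1.
Proof. by rewrite mul1r. Qed.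

Fact units_inv_subproof (u : units) : (unit_pair u).2 * (unit_pair u).1 == 1.
Proof. by rewrite mulrC unit_pairP. Qed.

Definition units_mul (u v : units) : units :=
  @Units ((unit_pair u).1 * (unit_pair v).1, (unit_pair u).2 * (unit_pair v).2)
    (units_mul_subproof u v).
Definition units_one : units := @Units (1, 1) units_one_subproof.
Definition units_inv (u : units) : units :=
  @Units ((unit_pair u).2, (unit_pair u).1) (units_inv_subproof u).

Fact units_mulA : associative units_mul.
Proof. by move=> u v t; apply: uval_inj; rewrite /uval /= mulrA. Qed.
Fact units_mul1 : left_id units_one units_mul.
Proof. by move=> u; apply: uval_inj; rewrite /uval /= mul1r. Qed.
Fact units_mulr1 : right_id units_one units_mul.
Proof. by move=> u; apply: uval_inj; rewrite /uval /= mulr1. Qed.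
Fact units_mulV : left_inverse units_one units_inv units_mul.
Proof. by move=> u; apply: uval_inj; exact/eqP/units_inv_subproof. Qed.
Fact units_mulrV : right_inverse units_one units_inv units_mul.
Proof. by move=> u; apply: uval_inj; exact/eqP/unit_pairP. Qed.

HB.instance Definition _ := isGroup.Build units
  units_mulA units_mul1 units_mulr1 units_mulV units_mulrV.

Lemma uval1 : uval 1%g = 1.
Proof. by []. Qed.

Lemma uvalM (u v : units) : uval (u * v)%g = uval u * uval v.
Proof. by []. Qed.

Lemma uvalV (u : units) : uval u * uval (u^-1)%g = 1.
Proof. by rewrite -uvalM mulgV. Qed.

Lemma units_mulC (u v : units) : (u * v = v * u)%g.
Proof. by apply: uval_inj; rewrite !uvalM mulrC. Qed.

Lemma units_surj (a b : R) : a * b = 1 -> exists u : units, uval u = a.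
Proof. by move=> /eqP ab; exists (@Units (a, b) ab). Qed.

End Units.

Section Bracket.
Local Open Scope ring_scope.
Variables (X : biquandle) (R : comPzRingType).

Section Identities.
Variables (A B : X -> X -> units R) (delta : R) (w : units R).
Local Notation a x y := (uval (A x y)).
Local Notation b x y := (uval (B x y)).
Local Notation aV x y := (uval (A x y)^-1%g).
Local Notation bV x y := (uval (B x y)^-1%g).

Record bracket_identities : Prop := BracketIdentities {
  bracket_w : forall x,
    delta * a x x + b x x = uval w;
  bracket_wV : forall x,
    delta * aV x x + bV x x = uval w^-1%g;
  bracket_delta : forall x y,
    delta = - (a x y * bV x y) - (aV x y * b x y);
  bracket_AAA : forall x y z,
    a x y * a y z * a (x \under y) (z \over y)
    = a x z * a (y \over x) (z \over x) * a (x \under z) (y \under z);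
  bracket_ABB : forall x y z,
    a x y * b y z * b (x \under y) (z \over y)
    = b x z * b (y \over x) (z \over x) * a (x \under z) (y \under z);
  bracket_BAB : forall x y z,
    b x y * a y z * b (x \under y) (z \over y)
    = b x z * a (y \over x) (z \over x) * b (x \under z) (y \under z);
  bracket_AAB : forall x y z,
    a x y * a y z * b (x \under y) (z \over y)
    = a x z * b (y \over x) (z \over x) * a (x \under z) (y \under z)
      + a x z * a (y \over x) (z \over x) * b (x \under z) (y \under z)
      + delta * a x z * b (y \over x) (z \over x) * b (x \under z) (y \under z)
      + b x z * b (y \over x) (z \over x) * b (x \under z) (y \under z);
  bracket_BAA : forall x y z,
    b x z * a (y \over x) (z \over x) * a (x \under z) (y \under z)
    = b x y * a y z * a (x \under y) (z \over y)
      + a x y * b y z * a (x \under y) (z \over y)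
      + delta * b x y * b y z * a (x \under y) (z \over y)
      + b x y * b y z * b (x \under y) (z \over y)
}.

End Identities.

Definition biquandle_bracket (A B : X -> X -> units R) : Prop :=
  exists (delta : R) (w : units R), bracket_identities A B delta w.

End Bracket.

Section Cocycle.
Local Open Scope group_scope.

(* Meant for abelian G, such as G = units R (lemma units_mulC); commutativity is
   not needed to state the condition. *)
Definition cocycle2 (X : biquandle) (G : groupType) (phi : X -> X -> G) : Prop :=
  (forall x, phi x x = 1) /\
  (forall x y z,
     phi x y * phi y z * phi (x \under y) (z \over y)
     = phi x z * phi (y \over x) (z \over x) * phi (x \under z) (y \under z)).

Definition cocycle2_up_to_constant (X : biquandle) (G : groupType)
    (phi : X -> X -> G) : Prop :=
  exists (c : G) (psi : X -> X -> G),
    cocycle2 psi /\ forall x y, phi x y = c * psi x y.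

End Cocycle.

(* Main.v *)
Require Import Defs.
From mathcomp Require Import all_boot all_algebra.

(** The all-[A] identity of a bracket, read in the unit group, is the cubic
    cocycle identity for [A].  Specialising that identity to a repeated argument
    makes everything but two diagonal values cancel, so the diagonal of [A] is
    invariant under [x |-> x \under z] and [x |-> x \over z] (lemmas
    [diag_under] and [diag_over]).  Semi-transitivity reaches every element from
    a single one in one such step, hence the diagonal of [A] is constant.  Since
    both sides of the cocycle identity have degree three, dividing [A] by this
    constant preserves the identity and normalises the diagonal to [1]. *)

Set Implicit Arguments.
Unset Strict Implicit.

Local Open Scope group_scope.

(** A 2-cocycle without the normalisation of its diagonal: unlike [cocycle2],
    this condition is stable under constant multiples. *)
Definition cocycle_identity (X : biquandle) (G : groupType)
    (phi : X -> X -> G) : Prop :=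
  forall x y z,
    phi x y * phi y z * phi (x \under y) (z \over y)
    = phi x z * phi (y \over x) (z \over x) * phi (x \under z) (y \under z).

Section CocycleIdentity.
Variables (X : biquandle) (G : groupType) (phi : X -> X -> G).
Hypothesis mulGC : forall u v : G, u * v = v * u.
Hypothesis phi_id : cocycle_identity phi.

(** The case [y = x] of the identity: as [x \under x = x \over x], the factors
    [phi x z] and [phi (x \under x) (z \over x)] occur on both sides. *)
Lemma diag_under x z : phi (x \under z) (x \under z) = phi x x.
Proof.
have := phi_id x x z; rewrite biq_diag -mulgA.
by rewrite [RHS]mulGC => /mulIg ->.
Qed.

(** The case [z = y], symmetric to [diag_under]. *)
Lemma diag_over y x : phi (y \over x) (y \over x) = phi y y.
Proof. by have := phi_id x y y; rewrite biq_diag => /mulIg/mulgI ->. Qed.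

Lemma semi_transitive_diag_constant :
  semi_transitive X -> exists c, forall x, phi x x = c.
Proof.
case=> x0 reach; exists (phi x0 x0) => x.
by case: (reach x) => -[y ->]; rewrite (diag_under, diag_over).
Qed.

Lemma cocycle_identity_scale c : cocycle_identity (fun x y => c * phi x y).
Proof.
have mulGCA (u v t : G) : u * (v * t) = v * (u * t) by rewrite !mulgA (mulGC u).
have scale3 (u v t : G) : c * u * (c * v) * (c * t) = c * (c * (c * (u * v * t))).
  by rewrite -!mulgA (mulGCA v c) !(mulGCA u c).
by move=> x y z; rewrite !scale3 phi_id.
Qed.

Lemma semi_transitive_cocycle :
  semi_transitive X -> cocycle2_up_to_constant phi.
Proof.
case/semi_transitive_diag_constant=> c diagE.
exists c, (fun x y => c^-1 * phi x y); split; last first.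
  by move=> x y; rewrite mulgA mulgV mul1g.
by split; [move=> x; rewrite diagE mulVg | exact: cocycle_identity_scale].
Qed.

End CocycleIdentity.

Theorem corollary2 (X : biquandle) (R : comPzRingType)
    (A B : X -> X -> units R)
    (hX : semi_transitive X) (hAB : biquandle_bracket A B) :
  cocycle2_up_to_constant A.
Proof.
case: hAB => delta [w brAB].
apply: semi_transitive_cocycle hX; first exact: units_mulC.
by move=> x y z; apply: uval_inj; rewrite !uvalM; exact: (bracket_AAA brAB).
Qed.
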